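(* Let $n,f$ be integers with $1\le 2f\le n-1$ (i.e. $f\ge1$ and $n>2f$) and $\Pi$ a set of $n$ processes. There is an algorithm using the consistent oracle ${}^c\mathcal O.f\text{-TAg}(\Pi,f)$ that solves $(f+1)\text{-TAg}(\Pi,f)$; hence $(f+1)\text{-TAg}(n,f)$ is ${}^cC$-reducible to $f\text{-TAg}(n,f)$ (and therefore so is $\mathrm{Cons}(n,f)$).
   Context: Model: a finite set of processes runs an asynchronous algorithm communicating by reliable message passing with unbounded delays and speeds; processes fail only by crashing. Time is $\mathcal T=\mathbb N$; a failure pattern $F$ for $\Pi$ is a nondecreasing map $\mathcal T\to2^\Pi$, $Faulty(F)=\bigcup_tF(t)$. A binary agreement problem $P$ for $\Pi$ maps each $(F,\vec V)$, $\vec V\in\{0,1\}^\Pi$, to a nonempty $P(F,\vec V)\subseteq\{0,1\}$; a task is $T=(P,f)$. An algorithm solves $T$ if in every run with $|Faulty(F)|\le f$ and initial values $\vec V$: every correct process eventually decides, decisions are irrevocable, no two processes decide differently, and decisions lie in $P(F,\vec V)$. $k\text{-TAg}_\Pi(F,\vec V)=\{0\}$ if at least $k$ entries of $\vec V$ are $0$; $=\{1\}$ if $\vec V$ is all-ones and $|Faulty(F)|\le k-1$; $=\{0,1\}$ otherwise; $k\text{-TAg}(\Pi,f)=(k\text{-TAg}_\Pi,f)$; $k\text{-TAg}(n,f)$ and $\mathrm{Cons}(n,f)=n\text{-TAg}(n,f)$ are the versions for $\Pi=\{1,\dots,n\}$. Oracles: for $T=(P,f)$ on $\Pi$, an $f$-resilient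 oracle suitable for $P$ is a black box with consultants $\Pi$ whose history (for failure pattern $F$) is a sequence of successive consultations, in each of which every consultant may submit at most one query in $\{0,1\}$ and the oracle returns a common response $d$ with $d\in P(F,\vec V)$ for every $\vec V$ extending the partial query vector (the oracle may use the whole failure pattern, including future crashes), and every correct querier gets the response whenever at least $|\Pi|-f$ consultants query. Such an oracle is consistent if for every $F$, every history $H$ of it under $F$, and any two consultations in $H$ with query vectors $\vec W_1,\vec W_2$ such that $\vec W_1$ extends $\vec W_2$ (as partial functions), the oracle answers $d$ in the consultation with $\vec W_2$ only if it answers $d$ in the consultation with $\vec W_1$. ${}^c\mathcal O.T$ denotes the most general consistent $f$-resilient oracle suitable for $P$. $T_1\le_{{}^cC}T_2$ means there is an algorithm solving $T_1$ whose processes may additionally consult the oracle ${}^c\mathcal O.T_2$. *)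

(* Defs.v *)
From mathcomp Require Import all_boot.
Set Implicit Arguments. Unset Strict Implicit. Unset Printing Implicit Defensive.

Section Model.
Variable n : nat.

(* A failure pattern: F t = set of processes crashed by time t. *)
Definition fp_valid (F : nat -> {set 'I_n}) : Prop :=
  forall t t', t <= t' -> F t \subset F t'.
Definition correct (F : nat -> {set 'I_n}) (p : 'I_n) : Prop :=
  forall t, p \notin F t.
(* |Faulty(F)| <= k  (Faulty(F) = union of the nondecreasing F t) *)
Definition faulty_le (F : nat -> {set 'I_n}) (k : nat) : Prop :=
  forall t, #|F t| <= k.

Definition TAg (k : nat) (F : nat -> {set 'I_n}) (V : 'I_n -> bool) (d : bool)
  : Prop :=
  let zeros := #|[set p | ~~ V p]| in
  (k <= zeros -> d = false) /\
  (~ (k <= zeros) -> (forall p, V p = true) -> faulty_le F (k - 1) -> d = true).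

Inductive input (M : Type) : Type :=
  | In_none
  | In_msg of 'I_n & M              (* message m from sender q *)
  | In_resp of nat & bool.          (* oracle answer d of consultation k *)

(* One step of process p: from its state and input, new state, messages
   sent (destination, content), and possibly a query (its next
   consultation) to the oracle. *)
Record algorithm := Algorithm {
  St : Type;
  Msg : Type;
  init : 'I_n -> bool -> St;
  step : 'I_n -> St -> input Msg -> St * seq ('I_n * Msg) * option bool;
  decision : St -> option bool }.

(* Scheduler events; message events carry the identity (s, j) of the
   message = j-th message sent at time s, together with its sender and
   content (checked by admissibility). *)
Inductive event (M : Type) : Type :=
  | Ev_none
  | Ev_msg of nat & nat & 'I_n & M
  | Ev_resp of nat & bool.

Definition input_of M (e : event M) : input M :=
  match e with
  | Ev_none => In_none _
  | Ev_msg _ _ q m => In_msg q m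
  | Ev_resp k d => In_resp _ k d
  end.

Section Run.
Variable A : algorithm.
Variable V : 'I_n -> bool.
Variable sch : nat -> option ('I_n * event (Msg A)).

Fixpoint cfg (t : nat) : 'I_n -> St A :=
  match t with
  | 0 => fun p => @init A p (V p)
  | t'.+1 =>
      let c := cfg t' in
      match sch t' with
      | None => c
      | Some (p, e) =>
          fun r => if r == p then (@step A p (c p) (input_of e)).1.1 else c r
      end
  end.

Definition out (t : nat) : option ('I_n * seq ('I_n * Msg A) * option bool) :=
  match sch t with
  | None => None
  | Some (p, e) =>
      let r := @step A p (cfg t p) (input_of e) in Some (p, r.1.2, r.2)
  end.

Definition qry (t : nat) (p : 'I_n) : option bool :=
  match out t with
  | Some (q, _, Some b) => if q == p then Some b else None
  | _ => None
  end.

(* number of queries submitted by p strictly before time t; the query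
   submitted at time t is thus in consultation number nq t p *)
Definition nq (t : nat) (p : 'I_n) : nat :=
  count (fun s => qry s p != None) (iota 0 t).

Definition queried (k : nat) (p : 'I_n) (b : bool) : Prop :=
  exists s, qry s p = Some b /\ nq s p = k.
Definition queried_before (tau k : nat) (p : 'I_n) (b : bool) : Prop :=
  exists s, s < tau /\ qry s p = Some b /\ nq s p = k.

(* ---------- admissible runs with the consistent oracle ----------
   rsp k = Some (tau, d): the oracle answers d in consultation k at time tau;
   rsp k = None: consultation k is never answered.
   The oracle is the most general consistent f-resilient oracle suitable
   for ko-TAg. *)
Definition admissible (fo ko : nat) (F : nat -> {set 'I_n})
  (rsp : nat -> option (nat * bool)) : Prop :=
  (forall t p e, sch t = Some (p, e) -> p \notin F t) /\
  (forall p, correct F p -> forall t, exists t' e, t <= t' /\ sch t' = Some (p, e)) /\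
  (forall t p s j q m, sch t = Some (p, Ev_msg s j q m) ->
     s < t /\ exists ms qo, out s = Some (q, ms, qo) /\ onth ms j = Some (p, m)) /\
  (forall t t' p p' s j q q' m m', sch t = Some (p, Ev_msg s j q m) ->
     sch t' = Some (p', Ev_msg s j q' m') -> t = t') /\
  (forall s q ms qo j p m, out s = Some (q, ms, qo) -> onth ms j = Some (p, m) ->
     correct F p -> exists t, sch t = Some (p, Ev_msg s j q m)) /\
  (forall t p k d, sch t = Some (p, Ev_resp _ k d) ->
     (exists b, queried_before t k p b) /\
     exists tau, tau <= t /\ rsp k = Some (tau, d)) /\
  (forall t t' p k d d', sch t = Some (p, Ev_resp _ k d) ->
     sch t' = Some (p, Ev_resp _ k d') -> t = t') /\
  (forall p k b tau d, correct F p -> queried k p b -> rsp k = Some (tau, d) ->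
     exists t, sch t = Some (p, Ev_resp _ k d)) /\
  (* suitability: the answer is valid for every extension of the partial
     query vector at response time *)
  (forall k tau d, rsp k = Some (tau, d) ->
     forall V' : 'I_n -> bool,
       (forall p b, queried_before tau k p b -> V' p = b) -> TAg ko F V' d) /\
  (forall k, (exists S : {set 'I_n}, n - fo <= #|S| /\
                forall p, p \in S -> exists b, queried k p b) ->
     exists tau d, rsp k = Some (tau, d)) /\
  (* consistency: W1 extends W2 and answer d to W2 ==> answer d to W1 *)
  (forall k1 k2 tau2 d, (forall p b, queried k2 p b -> queried k1 p b) ->
     rsp k2 = Some (tau2, d) -> exists tau1, rsp k1 = Some (tau1, d)).

End Run.

Definition solves_with (A : algorithm) (k f ko fo : nat) : Prop :=
  forall (F : nat -> {set 'I_n}) (V : 'I_n -> bool)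
         (sch : nat -> option ('I_n * event (Msg A)))
         (rsp : nat -> option (nat * bool)),
    fp_valid F -> faulty_le F f -> admissible V sch fo ko F rsp ->
    (forall p, correct F p -> exists t d, @decision A (cfg V sch t p) = Some d) /\
    (forall p t t' d, t <= t' -> @decision A (cfg V sch t p) = Some d ->
       @decision A (cfg V sch t' p) = Some d) /\
    (forall p q t t' d d', @decision A (cfg V sch t p) = Some d ->
       @decision A (cfg V sch t' q) = Some d' -> d = d') /\
    (forall p t d, @decision A (cfg V sch t p) = Some d -> TAg k F V d).

Definition cReducible (k1 k2 f : nat) : Prop :=
  exists A : algorithm, solves_with A k1 f k2 f.

End Model.

(* Main.v *)
Require Import Defs.
From mathcomp Require Import all_boot zify.
From Stdlib Require Import Classical.
Set Implicit Arguments. Unset Strict Implicit. Unset Printing Implicit Defensive.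

(** Every process queries [true] in consultation 0, and in consultation 1 it
    queries the binary value [w] obtained by collecting [n - f] initial values
    ([w] is [true] iff none of them is [false]); in parallel all processes run
    a deterministic Ben-Or protocol on the values [w].

    If consultation 0 is answered [true], the answer of consultation 1 is
    decided: were all queries of consultation 1 equal to [true], its query
    vector would be extended by that of consultation 0, so that consistency
    forces the answer [true]; and queries all equal to [false] are answered
    [false] by suitability.

    If consultation 0 is answered [false] although it contains no [false]
    query, suitability implies that exactly [f] processes are faulty.  The
    Ben-Or decision is taken: it is always safe since [n > 2 f], and in every
    phase that no faulty process reaches, all correct processes collect exactly
    the messages of the [n - f] correct ones, so they act identically and
    decide. *)

(** * Ben-Or phases *)

Section Views.
Variable n : nat.

Definition view := {ffun 'I_n -> option (option bool)}.

Definition dom (W : view) : {set 'I_n} := [set q | W q != None].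

Definition all_eq (W : view) (u : option bool) : bool :=
  [forall q in dom W, W q == Some u].

(** On an empty view both tests succeed and the value is [Some true]; views with [n - f > 0] entries
    avoid this case. *)
Definition unanimous (W : view) : option bool :=
  if all_eq W (Some true) then Some true
  else if all_eq W (Some false) then Some false else None.

(* Odd phases exchange estimates and produce proposals ([None] is the empty
   proposal); even phases exchange proposals and produce estimates. *)
Definition next (k : nat) (W : view) : option bool :=
  if odd k then unanimous W
  else Some (~~ [exists q, W q == Some (Some false)]).

Definition decide (k : nat) (W : view) : option bool :=
  if odd k then None else unanimous W.

(* Phase 0 is run as a proposal phase in which only [false] can be proposed. *)
Definition encode (b : bool) : option bool := if b then None else Some false.

Lemma mem_dom (W : view) q u : W q = Some u -> q \in dom W.
Proof. by rewrite inE => ->. Qed.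

Lemma all_eqP (W : view) u :
  reflect (forall q u', W q = Some u' -> u' = u) (all_eq W u).
Proof.
apply: (iffP forall_inP) => [H q u' Wq|H q].
  by have /eqP := H q (mem_dom Wq); rewrite Wq => -[].
by rewrite inE; case Wq: (W q) => [u'|] // _; rewrite (H _ _ Wq).
Qed.

Lemma unanimousP (W : view) v : unanimous W = Some v -> all_eq W (Some v).
Proof.
by rewrite /unanimous; case: ifP => [? [<-] //|_]; case: ifP => [? [<-] //|].
Qed.

Lemma unanimousT (W : view) v q :
  q \in dom W -> all_eq W (Some v) -> unanimous W = Some v.
Proof.
rewrite inE; case Wq: (W q) => [u|] // _ allW; rewrite /unanimous.
case: v allW => [->//|allW]; case: ifP => [/all_eqP allT|_]; last by rewrite allW.
by move/all_eqP: allW => allW; have := allT _ _ Wq; rewrite (allW _ _ Wq).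
Qed.

End Views.

(** * Safety of the phases: quorum intersection and locking *)

Section Phases.
Variables (n f : nat) (V : 'I_n -> bool).
Variable sent : nat -> 'I_n -> option bool -> Prop.

Definition is_view (k : nat) (W : view n) : Prop :=
  (forall q u, W q = Some u -> sent k q u) /\ n - f <= #|dom W|.

Hypothesis lt_2f_n : 2 * f < n.
Hypothesis sent_inj : forall k p u u', sent k p u -> sent k p u' -> u = u'.
Hypothesis sent0 : forall p u, sent 0 p u -> u = encode (V p).
Hypothesis sentS : forall k p u, sent k.+1 p u ->
  exists2 W, is_view k W & u = next k W.

Definition all_sent (k : nat) (u : option bool) : Prop :=
  forall p u', sent k p u' -> u' = u.

Lemma sets_meet (A B : {set 'I_n}) : n < #|A| + #|B| -> exists q, q \in A :&: B.
Proof.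
rewrite -cardsUI => lt_n; apply/card_gt0P.
have := subset_leq_card (subsetT (A :|: B)); rewrite cardsT card_ord; lia.
Qed.

(** Two sets of [n - f] senders intersect since [n > 2f], and a sender has one message per phase. *)
Lemma views_meet k W W' : is_view k W -> is_view k W' ->
  exists q u, W q = Some u /\ W' q = Some u.
Proof.
move=> [sW cW] [sW' cW']; have [|q] := @sets_meet (dom W) (dom W'); first lia.
rewrite !inE; case Wq: (W q) => [u|] //; case W'q: (W' q) => [u'|] // _.
exists q, u; split=> //.
by rewrite W'q (sent_inj (sW _ _ Wq) (sW' _ _ W'q)).
Qed.

Lemma view_inhabited k W : is_view k W -> exists q u, W q = Some u /\ sent k q u.
Proof.
move=> vW; have [q [u [Wq _]]] := views_meet vW vW.
by exists q, u; split=> //; apply: vW.1.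
Qed.

(** Phase 0 can only propose [false]; later proposals come from unanimous views, and two of these
    share an entry. *)
Lemma proposal_unique k p q v v' : ~~ odd k ->
  sent k p (Some v) -> sent k q (Some v') -> v = v'.
Proof.
case: k => [_ /sent0 + /sent0|k /=].
  by case: (V p) => // -[->]; case: (V q) => // -[->].
rewrite negbK => ok /sentS[W vW] + /sentS[W' vW']; rewrite /next ok.
move=> /esym/unanimousP/all_eqP allW /esym/unanimousP/all_eqP allW'.
have [r [u [/allW uv /allW' uv']]] := views_meet vW vW'.
by move: uv'; rewrite uv => -[].
Qed.

(** Every view of phase [k] shares an entry with the deciding one, so it contains [Some v] and, by
    [proposal_unique], no opposite proposal. *)
Lemma decide_lock k W v : is_view k W -> decide k W = Some v ->
  all_sent k.+1 (Some v).
Proof.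
rewrite /decide; case: ifP => // /negbT ek vW /unanimousP/all_eqP allW p u.
case/sentS=> W' vW' ->; rewrite /next (negbTE ek); congr Some.
have [r [w [Wr W'r]]] := views_meet vW vW'.
move: Wr W'r => /[dup] /allW -> _ W'r.
(* The estimate [false] needs one occurrence of [false]; the estimate [true] needs the absence of
   any. *)
case: v allW W'r => [allW W'r|_ W'r]; last first.
  by apply/negbTE; rewrite negbK; apply/existsP; exists r; rewrite W'r.
apply/existsPn => q; apply/eqP => W'q.
by have := proposal_unique ek (vW'.1 _ _ W'r) (vW'.1 _ _ W'q).
Qed.

Lemma all_sent_view k W u : all_sent k u -> is_view k W -> all_eq W u.
Proof. by move=> alls [sW _]; apply/all_eqP => q u' /sW/alls. Qed.

Lemma all_sent_unanimous k W v :
  all_sent k (Some v) -> is_view k W -> unanimous W = Some v.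
Proof.
move=> alls vW; have [q [u [Wq _]]] := view_inhabited vW.
exact: unanimousT (mem_dom Wq) (all_sent_view alls vW).
Qed.

Lemma all_sentS k v : all_sent k (Some v) -> all_sent k.+1 (Some v).
Proof.
move=> alls p u /sentS[W vW ->]; rewrite /next.
case: ifP => _; first exact: all_sent_unanimous vW.
have /all_eqP allW := all_sent_view alls vW.
have [q [w [/[dup] Wq /allW wv _]]] := view_inhabited vW; rewrite {}wv in Wq.
congr Some; case: v alls allW Wq => [alls allW Wq|alls allW Wq].
  by apply/existsPn => r; apply/eqP => /allW.
by apply/negbTE; rewrite negbK; apply/existsP; exists q; rewrite Wq.
Qed.

Lemma all_sent_leq k k' v :
  k <= k' -> all_sent k (Some v) -> all_sent k' (Some v).
Proof.
move/subnK<-; elim: (k' - k) => [//|m IH] alls.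
by rewrite addSn; apply: all_sentS; apply: IH.
Qed.

(** The earlier decision locks all later phases; within one phase the two views share an entry. *)
Lemma decide_agree k k' W W' v v' : is_view k W -> is_view k' W' ->
  decide k W = Some v -> decide k' W' = Some v' -> v = v'.
Proof.
wlog le_kk' : k k' W W' v v' / k <= k'.
  move=> H vW vW' d d'; case: (leqP k k') => [|/ltnW] le; first exact: (H k k' W W').
  by apply/esym; apply: (H k' k W' W).
move=> vW vW' dW; have lock := decide_lock vW dW.
move: dW; rewrite /decide; case: ifP => // ek dW; case: ifP => // ek'.
move: le_kk'; rewrite leq_eqVlt => /orP[/eqP kk'|lt_kk'].
  subst k'; move: dW => /unanimousP/all_eqP allW /unanimousP/all_eqP allW'.
  have [r [u [/allW uv /allW']]] := views_meet vW vW'.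
  by rewrite uv => -[].
by rewrite (all_sent_unanimous (all_sent_leq lt_kk' lock) vW') => -[].
Qed.

Lemma sent1_true : (forall p, V p) -> all_sent 1 (Some true).
Proof.
move=> V1 p u /sentS[W vW ->]; rewrite /next /=; congr Some.
by apply/existsPn => q; apply/eqP => /vW.1/sent0; rewrite V1.
Qed.

(** At least [f + 1] zeros and [n - f] senders together exceed [n]: this is where the threshold
    [f + 1] enters. *)
Lemma zeros_meet_view k W : f < #|[set p | ~~ V p]| -> is_view k W ->
  exists q u, ~~ V q /\ W q = Some u.
Proof.
move=> z [_ cW]; have [|q] := @sets_meet [set p | ~~ V p] (dom W).
  by apply: leq_trans (leq_add z cW); lia.
by rewrite !inE; case Wq: (W q) => [u|]; rewrite ?andbF // => /andP[? _]; exists q, u.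
Qed.

Lemma sent1_false : f < #|[set p | ~~ V p]| -> all_sent 1 (Some false).
Proof.
move=> z p u /sentS[W vW ->]; rewrite /next /=; congr Some.
have [q [w [Vq Wq]]] := zeros_meet_view z vW.
apply/negbTE; rewrite negbK; apply/existsP; exists q; rewrite Wq.
by rewrite (sent0 (vW.1 _ _ Wq)) (negbTE Vq).
Qed.

Lemma decide_true k W v : (forall p, V p) -> is_view k W ->
  decide k W = Some v -> v = true.
Proof.
move=> V1 vW; rewrite /decide; case: ifP => // _.
case: k vW => [|k] vW; last first.
  by rewrite (all_sent_unanimous (all_sent_leq _ (sent1_true V1)) vW) // => -[].
(* In phase 0 all messages are now the empty proposal, so nothing can be decided. *)
have [q [u [Wq sq]]] := view_inhabited vW; move/unanimousP/all_eqP => allW.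
by move: (allW _ _ Wq) (sent0 sq); rewrite V1 => ->.
Qed.

Lemma decide_false k W v : f < #|[set p | ~~ V p]| -> is_view k W ->
  decide k W = Some v -> v = false.
Proof.
move=> z vW; rewrite /decide; case: ifP => // _.
case: k vW => [|k] vW; last first.
  by rewrite (all_sent_unanimous (all_sent_leq _ (sent1_false z)) vW) // => -[].
have [q [u [Vq Wq]]] := zeros_meet_view z vW; move/unanimousP/all_eqP => allW.
move: (allW _ _ Wq) (sent0 (vW.1 _ _ Wq)); rewrite (negbTE Vq) => ->.
by case.
Qed.

(** * Termination once at most [n - f] processes send *)

Section Late.
Variables (C : {set 'I_n}) (K : nat).
Hypothesis cardC : #|C| <= n - f.
Hypothesis late : forall k p u, K <= k -> sent k p u -> p \in C.

(** Each domain lies in [C] and has at least [n - f] elements, hence equals [C]. *)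
Lemma late_view_eq k W W' : K <= k -> is_view k W -> is_view k W' -> W = W'.
Proof.
move=> le_Kk.
have domE U : is_view k U -> dom U = C.
  move=> [sU cU]; apply/eqP; rewrite eqEcard (leq_trans cardC cU) andbT.
  apply/subsetP => q; rewrite inE; case Uq: (U q) => [u|] // _.
  exact: late le_Kk (sU _ _ Uq).
move=> vW vW'; apply/ffunP => q.
have := domE _ vW; rewrite -(domE _ vW') => /setP/(_ q); rewrite !inE.
case Wq: (W q) => [u|]; case W'q: (W' q) => [u'|] // _.
by rewrite (sent_inj (vW.1 _ _ Wq) (vW'.1 _ _ W'q)).
Qed.

Lemma late_all_sent k p u : K < k -> sent k p u -> all_sent k u.
Proof.
case: k => // k lt_Kk /sentS[W vW ->] q u' /sentS[W' vW' ->].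
by rewrite (late_view_eq _ vW vW').
Qed.

(** All messages of phase [k] coincide. A common nonempty proposal is decided at once; if all are
    empty, every estimate of phase [k.+1] is the default [true], which is then proposed by all and
    decided in phase [k.+2]. *)
Lemma late_decide k W W' : K < k -> ~~ odd k ->
  is_view k W -> is_view k.+2 W' -> decide k W <> None \/ decide k.+2 W' <> None.
Proof.
move=> lt_Kk ek vW vW'; rewrite /decide /= negbK (negbTE ek).
have [q [u [_ /(late_all_sent lt_Kk)]]] := view_inhabited vW.
case: u => [v|] alls.
  by left; rewrite (all_sent_unanimous alls vW).
right; have alls1 : all_sent k.+1 (Some true).
  move=> p u /sentS[U vU ->]; rewrite /next (negbTE ek); congr Some.
  by apply/existsPn => r; apply/eqP => /vU.1/alls.
by rewrite (all_sent_unanimous (all_sentS alls1) vW').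
Qed.

End Late.
End Phases.

(** * The algorithm *)

Section Algorithm.
Variables n f : nat.

(* [phase] counts the broadcasts made so far; hence in phase [k.+1] the process
   waits for messages of phase [k]. *)
Record state := State {
  phase : nat;
  initial : option bool;
  log : nat -> view n;
  resp : nat -> option bool;
  decided : option bool }.

Definition message := (nat * option bool)%type.

Definition start (p : 'I_n) (b : bool) : state :=
  State 0 (encode b) (fun _ => [ffun=> None]) (fun _ => None) None.

Definition receive (s : state) (i : input n message) : state :=
  match i with
  | In_none => s
  | In_msg q (k, u) =>
      State (phase s) (initial s)
        (fun k' => if k' == k then [ffun r => if r == q then Some u else log s k r]
                   else log s k')
        (resp s) (decided s)
  | In_resp k d =>
      State (phase s) (initial s) (log s)
        (fun k' => if k' == k then Some d else resp s k') (decided s)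
  end.

Definition ready (s : state) : bool :=
  if phase s is k.+1 then n - f <= #|dom (log s k)| else true.

Definition value (s : state) : option bool :=
  if phase s is k.+1 then next k (log s k) else initial s.

Definition advance (s : state) : state :=
  State (phase s).+1 (initial s) (log s) (resp s)
    (if decided s is Some d then Some d
     else if phase s is k.+1 then decide k (log s k) else None).

Definition post (s : state) : state := if ready s then advance s else s.

Definition messages (s : state) : seq ('I_n * message) :=
  if ready s then [seq (q, (phase s, value s)) | q <- enum 'I_n] else [::].

Definition query (s : state) : option bool :=
  if ready s then
    match phase s with 0 => Some true | 1 => value s | _ => None end
  else None.

(* The answer [true] to the all-ones consultation 0 certifies, by consistency,
   the answer of consultation 1; the answer [false] certifies that exactly [f]
   processes are faulty, which makes the Ben-Or phases terminate. *)
Definition outcome (s : state) : option bool :=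
  match resp s 0 with
  | Some true => resp s 1
  | Some false => decided s
  | None => None
  end.

Definition oracle_benor : algorithm n :=
  @Algorithm n state message start
    (fun _ s i => let s' := receive s i in (post s', messages s', query s'))
    outcome.

Lemma phase_receive s i : phase (receive s i) = phase s.
Proof. by case: i => [|q [k u]|k d]. Qed.

Lemma initial_receive s i : initial (receive s i) = initial s.
Proof. by case: i => [|q [k u]|k d]. Qed.

Lemma decided_receive s i : decided (receive s i) = decided s.
Proof. by case: i => [|q [k u]|k d]. Qed.

Lemma phase_post s : phase (post s) = phase s + ready s.
Proof. by rewrite /post; case: (ready s); rewrite /= ?addn0 ?addn1. Qed.

Lemma initial_post s : initial (post s) = initial s.
Proof. by rewrite /post; case: ifP. Qed.

Lemma log_post s : log (post s) = log s.
Proof. by rewrite /post; case: ifP. Qed.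

Lemma resp_post s : resp (post s) = resp s.
Proof. by rewrite /post; case: ifP. Qed.

Lemma decided_post s d : decided s = Some d -> decided (post s) = Some d.
Proof. by rewrite /post; case: ifP => //= _ ->. Qed.

Lemma dom_receive s i k : dom (log s k) \subset dom (log (receive s i) k).
Proof.
case: i => [|q [k' u]|k' d] //=; case: eqP => [->|//].
by apply/subsetP => r; rewrite !inE ffunE; case: (r =P q).
Qed.

Lemma messagesP s j p m : onth (messages s) j = Some (p, m) ->
  ready s /\ m = (phase s, value s).
Proof.
rewrite /messages; case: ifP => [_|_]; last by rewrite onth0n.
by rewrite onth_map; case: onth => //= r [].
Qed.

Lemma messages_onth s p : ready s ->
  exists j, onth (messages s) j = Some (p, (phase s, value s)).
Proof.
rewrite /messages => ->; have /onthP[j Hj] : p \in enum 'I_n by rewrite mem_enum.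
by exists j; rewrite onth_map Hj.
Qed.

(** In phase 1 the value is an estimate [next 0], never empty, so exactly the first two broadcasts
    carry a query. *)
Lemma query_defined s : (query s != None) = ready s && (phase s < 2).
Proof.
by rewrite /query /value; case: ready => //; case: (phase s) => [|[|k]].
Qed.

(** * Runs: broadcasts and queries *)

Section Runs.
Variables (F : nat -> {set 'I_n}) (V : 'I_n -> bool).
Variable sch : nat -> option ('I_n * event n message).
Variable rsp : nat -> option (nat * bool).

Notation cfg := (@cfg n oracle_benor V sch).
Notation out := (@out n oracle_benor V sch).
Notation qry := (@qry n oracle_benor V sch).
Notation nq := (@nq n oracle_benor V sch).
Notation queried := (@queried n oracle_benor V sch).

Definition received t p e : state := receive (cfg t p) (input_of e).

(** Instance of the abstract [sent] of the phases; [sent_unique], [sent_phase0] and [sent_succ]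
    discharge the hypotheses on it. *)
Definition sent k p u : Prop :=
  exists t e, [/\ sch t = Some (p, e), ready (received t p e),
                  phase (cfg t p) = k & u = value (received t p e)].

Lemma cfg_step t p e : sch t = Some (p, e) -> cfg t.+1 p = post (received t p e).
Proof. by move=> /= ->; rewrite eqxx. Qed.

Lemma cfg_cases t p :
  cfg t.+1 p = cfg t p \/ exists2 e, sch t = Some (p, e) &
                                     cfg t.+1 p = post (received t p e).
Proof.
case E: (sch t) => [[q e]|]; last by left; rewrite /= E.
have [->|npq] := eqVneq p q; first by right; exists e; rewrite // (cfg_step E).
by left; rewrite /= E (negbTE npq).
Qed.

Lemma out_step t p e : sch t = Some (p, e) ->
  out t = Some (p, messages (received t p e), query (received t p e)).
Proof. by rewrite /Defs.out => ->. Qed.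

Lemma outP t p ms qo : out t = Some (p, ms, qo) ->
  exists e, [/\ sch t = Some (p, e), ms = messages (received t p e)
                & qo = query (received t p e)].
Proof.
by rewrite /Defs.out; case: (sch t) => [[q e]|] //= [<- <- <-]; exists e.
Qed.

Lemma qryP t p b : qry t p = Some b ->
  exists2 e, sch t = Some (p, e) & query (received t p e) = Some b.
Proof.
rewrite /Defs.qry; case E: out => [[[q ms] [b'|]]|] //; case: eqP => // qp [<-].
by have [e [? _ ?]] := outP E; subst q; exists e.
Qed.

Lemma qry_step t p e : sch t = Some (p, e) -> qry t p = query (received t p e).
Proof.
by move=> E; rewrite /Defs.qry (out_step E) eqxx; case: query.
Qed.

Lemma phase_leq t t' p : t <= t' -> phase (cfg t p) <= phase (cfg t' p).
Proof.
move/subnK<-; elim: (t' - t) => [//|m IH]; apply: leq_trans IH _; rewrite addSn.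
case: (cfg_cases (m + t) p) => [->//|[e _ ->]].
by rewrite phase_post phase_receive leq_addr.
Qed.

Lemma decided_leq t t' p d : t <= t' -> decided (cfg t p) = Some d ->
  decided (cfg t' p) = Some d.
Proof.
move/subnK<- => H; elim: (t' - t) => [//|m IH]; rewrite addSn.
case: (cfg_cases (m + t) p) => [->//|[e _ ->]].
by apply: decided_post; rewrite decided_receive.
Qed.

Lemma dom_leq t t' p k : t <= t' ->
  dom (log (cfg t p) k) \subset dom (log (cfg t' p) k).
Proof.
move/subnK<-; elim: (t' - t) => [//|m IH]; apply: subset_trans IH _.
rewrite addSn; case: (cfg_cases (m + t) p) => [->//|[e _ ->]].
by rewrite log_post dom_receive.
Qed.

Lemma initialE t p : initial (cfg t p) = encode (V p).
Proof.
elim: t => [//|t IH]; case: (cfg_cases t p) => [->//|[e _ ->]].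
by rewrite initial_post initial_receive.
Qed.

(** A broadcast increments the phase, which never decreases, so phase [k] is broadcast in a single
    step. *)
Lemma sent_unique k p u u' : sent k p u -> sent k p u' -> u = u'.
Proof.
move=> [t [e [E R P ->]]] [t' [e' [E' R' P' ->]]].
have lt_absurd s s' d : sch s = Some (p, d) -> ready (received s p d) ->
    phase (cfg s p) = k -> phase (cfg s' p) = k -> s < s' -> False.
  move=> Es Rs Ps Ps' /(phase_leq p).
  by rewrite (cfg_step Es) phase_post phase_receive Rs Ps Ps' addn1 ltnn.
have tt' : t = t'.
  by case: (ltngtP t t') => // /lt_absurd H; [case: (H _ E) | case: (H _ E')].
by subst t'; move: E'; rewrite E => -[<-].
Qed.

Lemma sent_phase0 p u : sent 0 p u -> u = encode (V p).
Proof.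
case=> t [e [_ _ P ->]].
by rewrite /value phase_receive P initial_receive initialE.
Qed.

Lemma phase_sent t p k : k < phase (cfg t p) -> exists u, sent k p u.
Proof.
elim: t => [//|t IH]; case: (cfg_cases t p) => [->//|[e E ->]].
rewrite phase_post phase_receive; case R: ready; rewrite ?addn0 // addn1 ltnS.
rewrite leq_eqVlt => /orP[/eqP kE|//].
by exists (value (received t p e)), t, e; split.
Qed.

(** Ties consultation numbers to phases: consultations 0 and 1 are queried along with the broadcasts
    of phases 0 and 1. *)
Lemma nqE t p : nq t p = minn 2 (phase (cfg t p)).
Proof.
elim: t => [//|t IH]; rewrite /Defs.nq -addn1 iotaD count_cat -/(nq t p) IH.
rewrite /= add0n addn0 addn1.
case: (cfg_cases t p) => [E|[e E ->]].
  rewrite E; case Q: (qry t p) => [b|]; last by rewrite addn0.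
  have [e Ee] := qryP Q.
  have := query_defined (received t p e) => + Qe; rewrite Qe => /esym/andP[R _].
  have := cfg_step Ee; rewrite E => /(congr1 phase).
  by rewrite phase_post phase_receive R; lia.
rewrite (qry_step E) query_defined phase_post phase_receive.
by case: ready; rewrite ?andTb; lia.
Qed.

Lemma queried0 p b : queried 0 p b -> b = true.
Proof.
case=> s [/qryP[e _]]; rewrite nqE /query phase_receive.
by case: ready => //; case: phase => [[<-]|[|k]].
Qed.

(** The query of consultation 1 doubles as the phase 1 message, so [sent1_true] and [sent1_false]
    apply to it. *)
Lemma queried1_sent p b : queried 1 p b -> sent 1 p (Some b).
Proof.
case=> s [/qryP[e E]]; rewrite nqE /query phase_receive.
case R: ready => //; case P: phase => [|[|k]] // vE _.
by exists s, e; split.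
Qed.

Lemma sent_queried0 p u : sent 0 p u -> queried 0 p true.
Proof.
case=> t [e [E R P _]]; exists t; rewrite nqE P (qry_step E) /query R.
by rewrite phase_receive P.
Qed.

Lemma sent_queried1 p u : sent 1 p u -> exists b, queried 1 p b.
Proof.
case=> t [e [E R P _]].
have : qry t p != None by rewrite (qry_step E) query_defined R phase_receive P.
by case Q: (qry t p) => [b|] // _; exists b, t; rewrite nqE P.
Qed.

Lemma queried1_queried0 p b : queried 1 p b -> queried 0 p true.
Proof.
move/queried1_sent=> [t [e [_ _ P _]]].
have [|u] := @phase_sent t p 0; first by rewrite P.
exact: sent_queried0.
Qed.

(** * Invariants of admissible runs *)

Hypothesis lt_2f_n : 2 * f < n.
Hypothesis f_gt0 : 0 < f.
Hypothesis F_valid : fp_valid F.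
Hypothesis F_le : faulty_le F f.
Hypothesis adm : @admissible n oracle_benor V sch f f F rsp.

Lemma delivered_sent t p s j q k u :
  sch t = Some (p, Ev_msg s j q (k, u)) -> sent k q u.
Proof.
have [_ [_ [msg_ok _]]] := adm.
case/msg_ok=> _ [ms [qo [/outP[e [E -> _]]]]] /messagesP[R [-> ->]].
by exists s, e; split; rewrite ?phase_receive.
Qed.

Lemma log_received t p e k q u : sch t = Some (p, e) ->
  (forall k q u, log (cfg t p) k q = Some u -> sent k q u) ->
  log (received t p e) k q = Some u -> sent k q u.
Proof.
move=> E IH; rewrite /received; case: e E => [|s j r [k' u']|k' d] E /=.
- exact: IH.
- case: eqP => [->|_]; last exact: IH.
  rewrite ffunE; case: eqP => [->|_]; last exact: IH.
  by case=> <-; apply: delivered_sent E.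
- exact: IH.
Qed.

Lemma log_cfg t p k q u : log (cfg t p) k q = Some u -> sent k q u.
Proof.
elim: t k q u => [|t IH] k q u; first by rewrite /= ffunE.
case: (cfg_cases t p) => [->|[e E ->]]; first exact: IH.
by rewrite log_post; apply: log_received.
Qed.

Lemma view_received t p e k : sch t = Some (p, e) -> ready (received t p e) ->
  phase (cfg t p) = k.+1 -> is_view f sent k (log (received t p e) k).
Proof.
move=> E; rewrite /ready phase_receive => R P; rewrite P in R; split=> // q u.
by apply: log_received => // ? ? ?; apply: log_cfg.
Qed.

Lemma sent_succ k p u : sent k.+1 p u ->
  exists2 W, is_view f sent k W & u = next k W.
Proof.
case=> t [e [E R P ->]]; exists (log (received t p e) k).
  exact: view_received.
by rewrite /value phase_receive P.
Qed.

Lemma resp_cfg t p k d : resp (cfg t p) k = Some d -> exists tau, rsp k = Some (tau, d).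
Proof.
elim: t => [//|t IH]; case: (cfg_cases t p) => [->//|[e E ->]].
rewrite resp_post /received; case: e E => [//|s j q [k' u] _ //|k' d'] E /=.
case: eqP => [->|//]; case=> <-.
have [_ [_ [_ [_ [_ [resp_ok _]]]]]] := adm.
by have [_ [tau [_ ?]]] := resp_ok _ _ _ _ E; exists tau.
Qed.

(** A stored answer may be overwritten, but only by the same value, the one fixed by [rsp k]. *)
Lemma resp_leq t t' p k d : t <= t' -> resp (cfg t p) k = Some d ->
  resp (cfg t' p) k = Some d.
Proof.
move/subnK<- => H; elim: (t' - t) => [//|m IH].
have [tau rspk] := resp_cfg H.
have : resp (cfg (m + t).+1 p) k <> None.
  case: (cfg_cases (m + t) p) => [->|[e E ->]]; first by rewrite IH.
  rewrite resp_post /received; case: e E => [|s j q [k' u] _|k' d' _] /=;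
    rewrite ?IH //.
  by case: eqP => // _; rewrite IH.
rewrite addSn; case R: resp => [d'|] // _.
by have [tau'] := resp_cfg R; rewrite rspk => -[_ ->].
Qed.

Lemma decided_cfg t p d : decided (cfg t p) = Some d ->
  exists k W, is_view f sent k W /\ decide k W = Some d.
Proof.
elim: t => [//|t IH]; case: (cfg_cases t p) => [->//|[e E ->]].
rewrite /post; case R: ready; last by rewrite decided_receive.
rewrite /= decided_receive; case D: decided => [d'|]; first by rewrite -D.
rewrite phase_receive; case P: phase => [//|k] dk.
by exists k, (log (received t p e) k); split=> //; apply: view_received.
Qed.

(** The view of phase [k] is evaluated on leaving phase [k.+1], whence the bound. *)
Lemma phase_view t p k : k.+1 < phase (cfg t p) -> exists W,
  is_view f sent k W /\ (decide k W <> None -> decided (cfg t p) <> None).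
Proof.
elim: t => [//|t IH]; case: (cfg_cases t p) => [->//|[e E cE]].
rewrite {1}cE phase_post phase_receive => lt_k.
case: (ltnP k.+1 (phase (cfg t p))) => [/IH [W [vW dW]]|ge_k].
  exists W; split=> // /dW; case D: decided => [d|] // _.
  by rewrite (decided_leq (leqnSn t) D).
have R : ready (received t p e) by move: lt_k ge_k; case: ready => //; lia.
have P : phase (cfg t p) = k.+1 by move: lt_k; rewrite R; lia.
exists (log (received t p e) k); split; first exact: view_received.
rewrite cE /post R /= decided_receive phase_receive P.
by case: decided.
Qed.

(** The cardinalities are bounded by [f]; without a maximum they would climb to [f.+1]. *)
Lemma faulty_stable : exists T, forall t, #|F t| <= #|F T|.
Proof.
have H m : (exists T, forall t, #|F t| <= #|F T|) \/ exists t, m <= #|F t|.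
  elim: m => [|m [?|[T leT]]]; [by right; exists 0 | by left |].
  have [?|nle] := classic (forall t, #|F t| <= #|F T|); first by left; exists T.
  have [t Ht] := not_all_ex_not _ _ nle.
  by right; exists t; apply: leq_ltn_trans leT _; rewrite ltnNge; apply/negP.
have [//|[t lt_ft]] := H f.+1.
by have := leq_ltn_trans (F_le t) lt_ft; rewrite ltnn.
Qed.

(** * Progress of correct processes *)

Section Stable.
Variable T : nat.
Hypothesis T_max : forall t, #|F t| <= #|F T|.

Lemma F_sub t : F t \subset F T.
Proof.
have [le|/ltnW le] := leqP t T; first exact: F_valid.
by have /eqP -> : F T == F t by rewrite eqEcard F_valid ?T_max.
Qed.

Lemma correctP p : p \in ~: F T <-> correct F p.
Proof.
rewrite inE; split=> [nF t|]; last by apply.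
by apply: contra nF; apply/subsetP/F_sub.
Qed.

Lemma card_correct : n - f <= #|~: F T|.
Proof. by rewrite cardsCs setCK card_ord leq_sub2l. Qed.

(** Induction for all correct processes at once: their messages of the previous phase all arrive,
    and there are at least [n - f] of them. *)
Lemma correct_phase k p : correct F p -> exists t, k <= phase (cfg t p).
Proof.
have [_ [fair [_ [_ [reliable _]]]]] := adm.
elim: k p => [|k IH] p cp; first by exists 0.
have [t0 le_k] := IH p cp.
have [t1 logged] : exists t1, k = 0 \/ n - f <= #|dom (log (cfg t1 p) k.-1)|.
  case: k IH le_k => [|k] IH le_k; first by exists 0; left.
  (* A common arrival time, by induction on the list of correct senders. *)
  have [t1 Ht1] : exists t1, forall q, q \in enum (~: F T) ->
      q \in dom (log (cfg t1 p) k).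
    have : {subset enum (~: F T) <= ~: F T} by move=> q; rewrite mem_enum.
    elim: (enum _) => [|q s IHs] sub; first by exists 0.
    have [|t2 Ht2] := IHs; first by move=> r rs; apply: sub; rewrite inE rs orbT.
    have /correctP cq : q \in ~: F T by apply: sub; rewrite mem_head.
    have [tq lt_q] := IH q cq; have [u [s0 [e [E R P _]]]] := phase_sent lt_q.
    have [j Hj] := messages_onth p R.
    have [t3 E3] := reliable _ _ _ _ _ _ _ (out_step E) Hj cp.
    exists (maxn t2 t3.+1) => r; rewrite inE => /orP[/eqP ->|/Ht2]; last first.
      exact/subsetP/dom_leq/leq_maxl.
    apply: (subsetP (dom_leq _ _ (leq_maxr t2 t3.+1))).
    rewrite (cfg_step E3) log_post /received /= phase_receive P eqxx.
    by rewrite inE ffunE eqxx.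
  exists t1; right; apply: leq_trans card_correct _; apply: subset_leq_card.
  by apply/subsetP => q qC; apply: Ht1; rewrite mem_enum.
have [t [e [le_t E]]] := fair p cp (maxn t0 t1).
move: le_t; rewrite geq_max => /andP[le0 le1].
have le_kt := leq_trans le_k (phase_leq p le0).
exists t.+1; rewrite (cfg_step E) phase_post phase_receive.
move: le_kt; rewrite leq_eqVlt => /orP[/eqP kE|lt].
  2: by exact: leq_trans lt (leq_addr _ _).
suff -> : ready (received t p e) by rewrite -kE addn1.
rewrite /ready phase_receive -kE; case: (k) logged => [//|k' [//|le]] /=.
apply: leq_trans le _; apply: subset_leq_card.
exact: subset_trans (dom_leq _ _ le1) (dom_receive _ _ _).
Qed.

Lemma correct_sent k p : correct F p -> exists u, sent k p u.
Proof. by case/(correct_phase k.+1) => t /phase_sent. Qed.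

Lemma correct_resp k p : k < 2 -> correct F p ->
  exists tau d t, rsp k = Some (tau, d) /\ resp (cfg t p) k = Some d.
Proof.
have [_ [_ [_ [_ [_ [_ [_ [deliv [_ [resil _]]]]]]]]]] := adm.
move=> lt_k2 cp.
have qk q : correct F q -> exists b, queried k q b.
  case/(correct_sent k) => u; case: k lt_k2 => [|[|//]] _.
    by move/sent_queried0; exists true.
  exact: sent_queried1.
have [|tau [d rk]] := resil k.
  by exists (~: F T); split=> [|q /correctP/qk //]; apply: card_correct.
have [b qb] := qk p cp; have [t E] := deliv _ _ _ _ _ cp qb rk.
by exists tau, d, t.+1; rewrite (cfg_step E) resp_post /= eqxx.
Qed.

Lemma late_sent : exists K, forall k p u, K <= k -> sent k p u -> p \in ~: F T.
Proof.
have [alive _] := adm.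
(* A faulty process broadcasts only before [T]; broadcasting phase [k] then makes its phase at [T]
   exceed [k], hence [k] is below this maximum. *)
exists (\max_p phase (cfg T p)) => k p u le_k [t [e [E R P _]]].
rewrite inE; apply/negP => pF.
have lt_t : t < T.
  rewrite ltnNge; apply/negP => le_Tt; move/negP: (alive _ _ _ E); apply.
  by apply: subsetP pF; apply: F_valid.
have := phase_leq p lt_t; rewrite (cfg_step E) phase_post phase_receive R P addn1.
by rewrite ltnNge; apply/negP; rewrite negbK; apply: leq_trans le_k; apply: leq_bigmax.
Qed.

Lemma correct_decided p : #|~: F T| <= n - f -> correct F p ->
  exists t d, decided (cfg t p) = Some d.
Proof.
move=> cardC cp; have [K late] := late_sent.
(* [K.+1.*2] is an even phase beyond [K]; the last [.+2] makes the view two phases later evaluated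
   as well. *)
have [t lt_t] := correct_phase (K.+1.*2.+2).+2 cp.
have [|W [vW dW]] := @phase_view t p K.+1.*2; first exact: ltn_trans lt_t.
have [W' [vW' dW']] := phase_view lt_t.
exists t; suff : decided (cfg t p) <> None by case: decided => // d _; exists d.
have [||/dW|/dW'] // := late_decide lt_2f_n sent_unique sent_succ cardC late _ _ vW vW'.
  by lia.
by rewrite odd_double.
Qed.

End Stable.

(** * Termination, stability, agreement and validity *)

Lemma resp0_false tau : rsp 0 = Some (tau, false) -> exists t, f <= #|F t|.
Proof.
have [_ [_ [_ [_ [_ [_ [_ [_ [suit _]]]]]]]]] := adm.
(* The all-ones vector extends the queries of consultation 0; with fewer than [f] crashes
   suitability would force the answer [true]. *)
move/suit=> /(_ (fun=> true)) [|_ H].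
  by move=> p b [s [_ Q]]; apply/esym/(@queried0 p); exists s.
apply: NNPP => nex.
suff : false = true by [].
apply: H => //.
  by rewrite (eq_card0 (A := [set _ | _])) ?leqn0 => [|p]; rewrite ?inE //; lia.
move=> t; case: (leqP f #|F t|) => [le|]; [by case: nex; exists t | lia].
Qed.

Lemma benor_termination p : correct F p -> exists t d, outcome (cfg t p) = Some d.
Proof.
move=> cp; have [T T_max] := faulty_stable.
have [tau0 [d0 [t0 [r0 R0]]]] := correct_resp T_max (isT : 0 < 2) cp.
case: d0 r0 R0 => r0 R0.
  have [tau1 [d1 [t1 [r1 R1]]]] := correct_resp T_max (isT : 1 < 2) cp.
  exists (maxn t0 t1), d1; rewrite /outcome (resp_leq (leq_maxl _ _) R0).
  exact: resp_leq (leq_maxr _ _) R1.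
have [t le_f] := resp0_false r0.
have [|t1 [d D]] := correct_decided T_max _ cp.
  by rewrite cardsCs setCK card_ord leq_sub2l // (leq_trans le_f).
exists (maxn t0 t1), d; rewrite /outcome (resp_leq (leq_maxl _ _) R0).
exact: decided_leq (leq_maxr _ _) D.
Qed.

Lemma benor_stability p t t' d : t <= t' ->
  outcome (cfg t p) = Some d -> outcome (cfg t' p) = Some d.
Proof.
move=> le; rewrite /outcome; case R0: (resp (cfg t p) 0) => [[]|] //;
  rewrite (resp_leq le R0); [exact: resp_leq | exact: decided_leq].
Qed.

(** The common answer of consultation 0 puts both processes on the same branch. *)
Lemma benor_agreement p q t t' d d' :
  outcome (cfg t p) = Some d -> outcome (cfg t' q) = Some d' -> d = d'.
Proof.
rewrite /outcome.
case R: (resp (cfg t p) 0) => [b|] //; case R': (resp (cfg t' q) 0) => [b'|] //.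
have [tau r] := resp_cfg R; have [tau'] := resp_cfg R'; rewrite r => -[_ <-].
case: b {R r} => [D D'|/decided_cfg[k [W [vW dW]]] /decided_cfg[k' [W' [vW' dW']]]].
  by have [tau1 r] := resp_cfg D; have [tau1'] := resp_cfg D'; rewrite r => -[_].
exact (decide_agree lt_2f_n sent_unique sent_phase0 sent_succ vW vW' dW dW').
Qed.

Lemma benor_validity p t d : outcome (cfg t p) = Some d -> TAg f.+1 F V d.
Proof.
have [_ [_ [_ [_ [_ [_ [_ [_ [suit [_ cons]]]]]]]]]] := adm.
rewrite /outcome; case R: (resp (cfg t p) 0) => [[|]|] //; last first.
  case/decided_cfg=> k [W [vW dW]]; split=> [z|_ V1 _].
    exact (decide_false lt_2f_n sent_unique sent_phase0 sent_succ z vW dW).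
  exact (decide_true lt_2f_n sent_unique sent_phase0 sent_succ V1 vW dW).
move=> D; have [tau0 r0] := resp_cfg R; have [tau1 r1] := resp_cfg D.
split=> [z|_ V1 _].
  (* More than [f] zeros make every query of consultation 1 [false], so the all-zeros vector extends
     them. *)
  have [|H _] := suit _ _ _ r1 (fun=> false).
    move=> q b [s [_ Q]].
    have /queried1_sent : queried 1 q b by exists s.
    move/(sent1_false lt_2f_n sent_phase0 sent_succ z).
    by case.
  apply: H; rewrite (_ : [set _ | _] = setT) ?cardsT ?card_ord; first by lia.
  by apply/setP => q; rewrite !inE.
(* Consistency: the ones of consultation 0 extend those of consultation 1, so an answer [d] to the
   latter is also the answer [true] to the former. *)
have [|tau] := cons 0 1 tau1 d _ r1; last by rewrite r0 => -[_].
move=> q b /[dup] /queried1_queried0 q0.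
by move/queried1_sent/(sent1_true sent_phase0 sent_succ V1) => [->].
Qed.

End Runs.

Lemma benor_solves : 0 < f -> 2 * f < n -> solves_with oracle_benor f.+1 f f f.
Proof.
move=> f_gt0 lt_2f_n F V sch rsp F_valid F_le adm; split; last split; last split.
- exact: benor_termination adm.
- exact: benor_stability adm.
- exact: benor_agreement adm.
- exact: benor_validity adm.
Qed.

End Algorithm.

(** Raising the threshold weakens the clause on zeros; the bound on crashes keeps the all-ones
    clause. Yields consensus from [f.+1] by taking [k' = n]. *)
Lemma TAg_leq n k k' F (V : 'I_n -> bool) d : 0 < k -> k <= k' ->
  faulty_le F (k - 1) -> TAg k F V d -> TAg k' F V d.
Proof.
move=> k_gt0 le_kk' Fk [H0 H1]; split=> [/(leq_trans le_kk')/H0 //|_ V1 _].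
apply: H1 => //; rewrite (_ : [set _ | _] = set0) ?cards0; first by lia.
by apply/setP => p; rewrite !inE V1.
Qed.

Theorem mainTheorem6 (n f : nat) : 1 <= f -> 2 * f < n ->
  cReducible n f.+1 f f /\ cReducible n n f f.
Proof.
move=> f_gt0 lt_2f_n; have solves := benor_solves f_gt0 lt_2f_n.
split; exists (oracle_benor n f) => // F V sch rsp F_valid F_le adm.
have [term [stab [agree valid]]] := solves F V sch rsp F_valid F_le adm.
split=> //; split=> //; split=> // p t d /valid; apply: TAg_leq => //; first by lia.
by rewrite subn1.
Qed.
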